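(* Let $n\ge1$ and let $\mathcal S_n\subset\{0,1\}^{n\times n}$ be the set of adjacency matrices of simple graphs on $n$ nodes. (i) For every directed multigraph with output pair $H=(V,E,(a,b))$ with $a\ne b$ and $|E|\le4$, and every $\varepsilon>0$, there is a PPGN++ network $F$ with $\max_{X\in\mathcal S_n}\max_{i,j}|F(X)_{ij}-P_H(X)_{ij}|<\varepsilon$. (ii) For every such $H$ with $a=b$ and $|E|\le5$, and every $\varepsilon>0$, there is a PPGN++ network $F$ with $\max_{X\in\mathcal S_n}\max_{i}|F(X)_{ii}-P_H(X)_{ii}|<\varepsilon$. (iii) For every such $H$ with $a=b$ and $|E|\le2$, and every $\varepsilon>0$, there is an MPNN $F$ with $\max_{X\in\mathcal S_n}\max_i|F(X)_i-P_H(X)_{ii}|<\varepsilon$. (In the paper's terminology: PPGN++ is at least 4 edge polynomial expressive and 5 node polynomial expressive, and MPNN is at least 2 node polynomial expressive.)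
   Context: A directed multigraph with output pair is $H=(V,E,(a,b))$ with $V=[m]$, $E$ a multiset of ordered pairs (loops and parallel edges allowed), $a,b\in V$ not necessarily distinct (red edge, not in $E$). $P_H(X)_{i_a,i_b}=\sum_{j\in[n]^m,\,j_a=i_a,\,j_b=i_b}\prod_{(r,s)\in E}X_{j_r,j_s}$ (with multiplicity, empty product $=1$), off-diagonal entries $0$ if $a=b$. A simple graph adjacency matrix is symmetric, 0/1, with zero diagonal. MLPs are finite-width feedforward networks with a continuous non-polynomial activation. MPNN: $Y^{(0)}=\mathbf 1\in\mathbb R^{n\times1}$, $Y^{(k+1)}=\mathtt m_k([XY^{(k)},\mathbf 1\mathbf 1^TY^{(k)},Y^{(k)}])$, brackets denoting concatenation along features and $\mathtt m_k$ an MLP applied to each row; output $F(X)\in\mathbb R^n$ is one feature column of the last layer. PPGN++: $Z^{(0)}=X\in\mathbb R^{n\times n\times1}$, $Z^{(k+1)}=\bar{\mathtt m}_3([\bar{\mathtt m}_1([Z^{(k)},Z^{(k)T}])\circledast\bar{\mathtt m}_2(Z^{(k)}),Z^{(k)}])$, with $Z^T$ transposing node indices channelwise, $\circledast$ channelwise matrix multiplication, and each $\bar{\mathtt m}_i$ a pair of MLPs, one applied to the feature vectors of diagonal entries and one to those of off-diagonal entries; output $F(X)\in\mathbb R^{n\times n}$ is one feature channel of the last layer. *)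

(* Defs.v *)
From HB Require Import structures.
From mathcomp Require Import all_boot all_order all_algebra.
From mathcomp Require Import reals topology normedtype.
Set Implicit Arguments. Unset Strict Implicit. Unset Printing Implicit Defensive.
Import Order.TTheory GRing.Theory Num.Theory numFieldNormedType.Exports.
Local Open Scope ring_scope.

Section Defs.
Variable R : realType.

(* V = 'I_m, E a multiset (list) of ordered pairs, (a,b) the red output pair *)
Record mgraph := MGraph {
  mg_m : nat;
  mg_E : seq ('I_mg_m * 'I_mg_m);
  mg_a : 'I_mg_m;
  mg_b : 'I_mg_m }.

(* P_H(X)_{i,i'} = sum over j : [m] -> [n] with j a = i, j b = i' of
   prod_{(r,s) in E} X_{j r, j s}.  (When a = b the off-diagonal entries are
   automatically 0, the sum being empty.) *)
Definition hom_poly (H : mgraph) (n : nat) (X : 'M[R]_n) : 'M[R]_n :=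
  \matrix_(i, i')
    \sum_(f : {ffun 'I_(mg_m H) -> 'I_n} | (f (mg_a H) == i) && (f (mg_b H) == i'))
      \prod_(e <- mg_E H) X (f e.1) (f e.2).

Definition simple_adj (n : nat) (X : 'M[R]_n) : Prop :=
  (forall i j, X i j = X j i) /\
  (forall i j, X i j = 0 \/ X i j = 1) /\
  (forall i, X i i = 0).

Definition is_polynomial_fun (s : R -> R) : Prop :=
  exists p : {poly R}, forall x, s x = p.[x].

Inductive mlp : nat -> nat -> Type :=
| mlp_affine (p q : nat) (W : 'M[R]_(p, q)) (b : 'rV[R]_q) : mlp p q
| mlp_layer (p h q : nat) (W : 'M[R]_(p, h)) (b : 'rV[R]_h) (rest : mlp h q) :
    mlp p q.

Fixpoint mlp_eval (s : R -> R) (p q : nat) (f : mlp p q) : 'rV[R]_p -> 'rV[R]_q :=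
  match f in mlp p q return 'rV[R]_p -> 'rV[R]_q with
  | mlp_affine _ _ W b => fun x => x *m W + b
  | mlp_layer _ _ _ W b rest => fun x => mlp_eval s rest (map_mx s (x *m W + b))
  end.

Inductive mpnn : nat -> Type :=
| mp_out (d : nat) (c : 'I_d) : mpnn d
| mp_layer (d d' : nat) (m : mlp (d + d + d) d') (rest : mpnn d') : mpnn d.

Fixpoint mpnn_run (s : R -> R) (n : nat) (X : 'M[R]_n) (d : nat) (N : mpnn d)
  : 'M[R]_(n, d) -> 'I_n -> R :=
  match N in mpnn d return 'M[R]_(n, d) -> 'I_n -> R with
  | mp_out _ c => fun Y i => Y i c
  | mp_layer d d' m rest => fun Y =>
      mpnn_run s X rest
        (\matrix_(i < n) mlp_eval s m
            (row i (row_mx (row_mx (X *m Y) ((const_mx 1 : 'M[R]_(n, n)) *m Y)) Y)))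
  end.

Definition mpnn_eval (s : R -> R) (n : nat) (N : mpnn 1) (X : 'M[R]_n) : 'I_n -> R :=
  mpnn_run s X N (const_mx 1).

Definition tens (n d : nat) := 'I_n -> 'I_n -> 'rV[R]_d.

Definition mlp2 (p q : nat) := (mlp p q * mlp p q)%type.

Definition mlp2_apply (s : R -> R) (n p q : nat) (m : mlp2 p q) (Z : tens n p)
  : tens n q :=
  fun i j => if i == j then mlp_eval s m.1 (Z i j) else mlp_eval s m.2 (Z i j).

Definition tens_cat (n p q : nat) (A : tens n p) (B : tens n q) : tens n (p + q) :=
  fun i j => row_mx (A i j) (B i j).

Definition tens_tr (n p : nat) (Z : tens n p) : tens n p := fun i j => Z j i.

Definition tens_mul (n p : nat) (A B : tens n p) : tens n p :=
  fun i j => \row_(c < p) \sum_(k < n) A i k 0 c * B k j 0 c.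

Inductive ppgn : nat -> Type :=
| pp_out (d : nat) (c : 'I_d) : ppgn d
| pp_layer (d d1 d' : nat) (m1 : mlp2 (d + d) d1) (m2 : mlp2 d d1)
    (m3 : mlp2 (d1 + d) d') (rest : ppgn d') : ppgn d.

Fixpoint ppgn_run (s : R -> R) (n : nat) (d : nat) (N : ppgn d)
  : tens n d -> 'M[R]_n :=
  match N in ppgn d return tens n d -> 'M[R]_n with
  | pp_out _ c => fun Z => \matrix_(i, j) Z i j 0 c
  | pp_layer d d1 d' m1 m2 m3 rest => fun Z =>
      ppgn_run s rest
        (mlp2_apply s m3
           (tens_cat (tens_mul (mlp2_apply s m1 (tens_cat Z (tens_tr Z)))
                               (mlp2_apply s m2 Z)) Z))
  end.

Definition ppgn_eval (s : R -> R) (n : nat) (N : ppgn 1) (X : 'M[R]_n) : 'M[R]_n :=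
  ppgn_run s N (fun i j => (X i j)%:M).

End Defs.

(* Main.v *)
Require Import Defs.
From HB Require Import structures.
From mathcomp Require Import all_boot all_order all_algebra.
From mathcomp Require Import boolp reals topology normedtype.
From mathcomp Require Import ring zify.
Set Implicit Arguments. Unset Strict Implicit. Unset Printing Implicit Defensive.
Import Order.TTheory GRing.Theory Num.Theory numFieldNormedType.Exports.
Local Open Scope ring_scope.

(* For fixed n there are finitely many simple graphs, so every network
   sees finitely many feature vectors, and approximation can be replaced by
   exact interpolation: a one-hidden-layer MLP takes arbitrary values on any
   finite set.  Otherwise some nontrivial relation sum_i c_i s(l t_i + b) = 0
   would hold for all l and b; eliminating its terms one by one turns it into
   the vanishing of all N-th finite differences of s, and a continuous function
   with this property is a polynomial.

   Hence PPGN++ computes every matrix obtained from X by entrywise operations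
   (distinguishing the diagonal), transposition and matrix products.  To compute
   P_H, sum out the vertices other than a and b one at a time: a vertex with at
   most two neighbours u, w disappears in favour of a single edge (u, w) labelled
   by a matrix product.  A vertex of degree at most 2 always exists, because
   with the red edge there are too few edges for a K_4 minor.  MPNN likewise
   sums out vertices with at most one neighbour. *)

(** * Finite differences and polynomials *)

Section Differences.
Variable R : realType.
Implicit Types (f g : R -> R) (p q : {poly R}) (h x : R).

Definition fdiff h f x : R := f (x + h) - f x.

Lemma eq_fdiff h f g : f =1 g -> fdiff h f =1 fdiff h g.
Proof. by move=> fg x; rewrite /fdiff !fg. Qed.

Lemma eq_iter_fdiff N h f g : f =1 g -> iter N (fdiff h) f =1 iter N (fdiff h) g.
Proof. by move=> fg; elim: N => //= N IH; apply: eq_fdiff. Qed.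

Lemma iter_fdiffB N h f g x :
  iter N (fdiff h) (fun y => f y - g y) x =
  iter N (fdiff h) f x - iter N (fdiff h) g x.
Proof.
elim: N x => //= N IH x; rewrite /fdiff !IH; ring.
Qed.

(** [p(X + h)] and [p] share their leading coefficient, so each difference lowers the degree. *)
Lemma iter_fdiff_horner N h p x :
  (size p <= N)%N -> iter N (fdiff h) (horner p) x = 0.
Proof.
elim: N p x => [|N IH] p x.
  by rewrite leqn0 size_poly_eq0 => /eqP->; rewrite /= horner0.
move=> sp; rewrite iterSr.
have E : fdiff h (horner p) =1 horner (p \Po ('X + h%:P) - p).
  by move=> y; rewrite /fdiff !hornerE horner_comp !hornerE.
rewrite (eq_iter_fdiff N h E); apply: IH.
have szXh : size ('X + h%:P : {poly R}) = 2 by rewrite size_XaddC.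
have [-> | p0] := eqVneq p 0; first by rewrite comp_poly0 subr0 size_poly0.
rewrite -ltnS; apply: leq_trans sp.
have [n sn] : exists n, size p = n.+1.
  by case E2: (size p) => [|n]; [move/eqP: E2; rewrite size_poly_eq0 (negPf p0)|exists n].
rewrite sn ltnS; apply/leq_sizeP => j; rewrite leq_eqVlt => /predU1P[<-|nj].
  rewrite coefB.
  have : lead_coef (p \Po ('X + h%:P)) = lead_coef p.
    by rewrite lead_coef_comp ?szXh // lead_coefXaddC expr1n mulr1.
  by rewrite !lead_coefE size_comp_poly2 // sn /= => ->; rewrite subrr.
by rewrite coefB !nth_default ?subr0 // ?size_comp_poly2 // sn.
Qed.

(** By induction the first difference vanishes along the whole progression, so [f] is constant
    there. *)
Lemma iter_fdiff_vanish N h f x0 :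
  (forall x, iter N (fdiff h) f x = 0) ->
  (forall j, (j < N)%N -> f (x0 + j%:R * h) = 0) ->
  forall j, f (x0 + j%:R * h) = 0.
Proof.
elim: N f => [|N IH] f Df f0 j; first exact: Df.
have step i : x0 + i.+1%:R * h = x0 + i%:R * h + h by rewrite -natr1; ring.
have D0 : forall i, fdiff h f (x0 + i%:R * h) = 0.
  apply: IH => [x|i iN]; first by rewrite -iterSr Df.
  by rewrite /fdiff -step !f0 ?subrr // ltnW.
elim: j => [|j IHj]; first exact: f0.
by have /eqP := D0 j; rewrite /fdiff IHj subr0 -step => /eqP.
Qed.

(** Newton interpolation: a multiple of [q], which vanishes at the old nodes, corrects the value at
    the new one. *)
Lemma interpolating_poly (xs : seq R) f : uniq xs ->
  exists2 p : {poly R}, (size p <= size xs)%N & {in xs, forall x, p.[x] = f x}.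
Proof.
elim: xs => [|x xs IH] /=; first by exists 0; rewrite ?size_poly0.
case/andP => xxs /IH[p sp pf].
pose q := \prod_(y <- xs) ('X - y%:P).
have qx : q.[x] != 0 by rewrite -rootE root_prod_XsubC.
exists (p + ((f x - p.[x]) / q.[x]) *: q).
  apply: (leq_trans (size_polyD _ _)); rewrite geq_max; apply/andP; split.
    exact: leq_trans sp _.
  by apply: (leq_trans (size_scale_leq _ _)); rewrite size_prod_XsubC.
move=> y; rewrite inE => /predU1P[->|yxs]; rewrite !hornerE.
  by rewrite divfK //; ring.
have /rootP -> : root q y by rewrite root_prod_XsubC.
by rewrite mulr0 addr0 pf.
Qed.

Lemma continuous_horner p : continuous (horner p).
Proof.
elim/poly_ind: p => [|p c IH] x.
  have -> : horner (0 : {poly R}) = (fun=> 0) by apply/funext => y; rewrite horner0.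
  exact: cvg_cst.
have -> : horner (p * 'X + c%:P) = (fun y => p.[y] * y + c).
  by apply/funext => y; rewrite !hornerE.
apply: cvgD; last exact: cvg_cst.
by apply: cvgM; [exact: IH|exact: cvg_id].
Qed.

Lemma vanish_nneg_rat f : continuous f ->
  (forall j m : nat, f (j%:R / m.+1%:R) = 0) -> forall x, 0 <= x -> f x = 0.
Proof.
move=> fc f0 x x0; apply/eqP/negPn/negP => fx.
have : \forall y \near x, `|f x - f y| < `|f x|.
  by have /cvgrPdist_lt/(_ _ _) := fc x; apply; rewrite normr_gt0.
move/nbhs_ballP => [e /= e0 be].
have [|q] := @rat_in_itvoo R x (x + e); first by rewrite ltrDl.
rewrite in_itv /= => /andP[xq qe].
have q0 : 0 < q by rewrite -(ltr0q R); apply: le_lt_trans xq.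
have : ball x e (ratr q : R).
  rewrite -ball_normE /ball_ /= distrC gtr0_norm ?subr_gt0 //.
  by rewrite ltrBlDl.
move/be; suff -> : f (ratr q) = 0 by rewrite subr0 ltxx.
have -> : ratr q = (`|numq q|%N)%:R / (`|denq q|%N.-1).+1%:R :> R.
  rewrite prednK ?absz_gt0 ?denq_neq0 // /ratr; congr (_ / _).
    by rewrite [RHS]pmulrn gez0_abs // ltW // numq_gt0.
  by rewrite [RHS]pmulrn gez0_abs // ltW // denq_gt0.
exact: f0.
Qed.

(* Frechet's characterisation of polynomials. *)
Lemma polynomial_of_iter_fdiff N f : continuous f ->
  (forall h x, iter N (fdiff h) f x = 0) -> is_polynomial_fun f.
Proof.
move=> fc Df.
have uniq_prog h : h != 0 -> uniq [seq i%:R * h | i <- iota 0 N].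
  move=> h0; rewrite map_inj_uniq ?iota_uniq // => i j /(mulIf h0) /eqP.
  by rewrite eqr_nat => /eqP.
(* [p] interpolates [f] at [0, ..., N - 1]; the remainder [r] will be shown to vanish everywhere. *)
have [p sp pf] := interpolating_poly f (uniq_prog 1 (oner_neq0 _)).
rewrite size_map size_iota in sp.
pose r x := f x - p.[x].
have Dr h x : iter N (fdiff h) r x = 0.
  by rewrite iter_fdiffB Df iter_fdiff_horner // subrr.
have r0 (j : nat) : (j < N)%N -> r j%:R = 0.
  move=> jN; rewrite /r -[j%:R]mulr1 pf ?subrr //.
  by apply: map_f; rewrite mem_iota.
have rc : continuous r.
  by move=> x; apply: cvgB; [exact: fc|exact: continuous_horner].
(* On the multiples of [h = 1/(m+1)], [r] agrees with a polynomial [q] of size at most [N]. These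
   multiples include [0, ..., N - 1], where [r] vanishes, so [q] has [N] roots and is zero. *)
have rrat j m : r (j%:R / m.+1%:R) = 0.
  set h := m.+1%:R^-1; have h0 : h != 0 by rewrite invr_neq0 // pnatr_eq0.
  have [q sq qr] := interpolating_poly r (uniq_prog h h0).
  rewrite size_map size_iota in sq.
  have rq i : r (i%:R * h) = q.[i%:R * h].
    apply/eqP; rewrite -subr_eq0 -[i%:R * h]add0r; apply/eqP.
    apply: (@iter_fdiff_vanish N h (fun y => r y - q.[y])) => [x|k kN].
      by rewrite iter_fdiffB Dr iter_fdiff_horner // subrr.
    by rewrite add0r qr ?subrr //; apply: map_f; rewrite mem_iota.
  have [q0|q0] := eqVneq q 0; first by rewrite rq q0 horner0.
  have qroots : all (root q) [seq i%:R * 1 | i <- iota 0 N].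
    apply/allP => y /mapP[i]; rewrite mem_iota /= => iN -> {y}.
    have -> : i%:R * 1 = (i * m.+1)%:R * h :> R.
      by rewrite natrM -mulrA divff // pnatr_eq0.
    rewrite rootE -rq natrM -mulrA divff ?pnatr_eq0 // mulr1.
    by rewrite r0.
  have := max_poly_roots q0 qroots (uniq_prog 1 (oner_neq0 _)).
  by rewrite size_map size_iota ltnNge sq.
have rpos := vanish_nneg_rat rc rrat.
exists p => x; apply/eqP; rewrite -subr_eq0; apply/eqP.
have [x0|x0] := leP 0 x; first exact: rpos.
(* For [x < 0], the progression of step [x] from [-N x] has its first [N] terms nonnegative, where
   [r] vanishes, and reaches [x] at index [N + 1]. *)
have := @iter_fdiff_vanish N x r (- (N%:R * x)) (Dr x) _ N.+1.
rewrite -natr1 mulrDl mul1r addrA addNr add0r; apply=> j jN.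
apply: rpos; rewrite -mulNr -mulrDl; apply: mulr_le0; last exact: ltW.
by rewrite addrC subr_le0 ler_nat ltnW.
Qed.

(* Replacing (l, b) by (l + d, b - d * t1) fixes the argument at t1, so
   subtracting the two relations removes one term and differences the others. *)
Lemma iter_fdiff_of_relation (l : seq (R * (R -> R))) t0 g h x :
  all (fun c => c.1 != t0) l ->
  (forall lam b, g (lam * t0 + b) + \sum_(c <- l) c.2 (lam * c.1 + b) = 0) ->
  iter (size l) (fdiff h) g x = 0.
Proof.
have [k] := ubnP (size l); elim: k l g => // k IH [|[t1 g1] l] g /=.
  by move=> _ _ /(_ 0 x); rewrite big_nil mul0r add0r addr0.
rewrite ltnS => lk /andP[t10 lt0] rel.
rewrite -iterS iterSr.
(* This [d] shifts the argument of the term at [t0] by exactly [h]. *)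
pose d := h / (t0 - t1).
have dh : d * (t0 - t1) = h by rewrite divfK // subr_eq0 eq_sym.
pose l' := [seq (c.1, fdiff (d * (c.1 - t1)) c.2) | c <- l].
have := IH l' (fdiff h g); rewrite size_map; apply => //.
  by rewrite all_map.
move=> lam b; rewrite big_map /=.
have := congr2 (fun u v => u - v) (rel (lam + d) (b - d * t1)) (rel lam b).
rewrite !big_cons /= subrr => E; rewrite -[RHS]E.
have E1 t : (lam + d) * t + (b - d * t1) = lam * t + b + d * (t - t1) by ring.
rewrite E1 dh [X in g1 X]E1 subrr mulr0 addr0.
under [X in _ = _ + (_ + X) - _]eq_bigr do rewrite E1.
rewrite /fdiff sumrB; ring.
Qed.

End Differences.

(** * Exact interpolation by one-hidden-layer MLPs *)

Section Interpolation.
Variables (R : realType) (s : R -> R).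
Hypotheses (s_cont : continuous s) (s_nonpoly : ~ is_polynomial_fun s).

(** Otherwise, isolating a term with nonzero coefficient and eliminating the others would make [s] a
    polynomial. *)
Lemma ridge_separates k (t : 'I_k -> R) (u : 'rV[R]_k) : injective t -> u != 0 ->
  exists lam b, \sum_i u 0 i * s (lam * t i + b) != 0.
Proof.
move=> tinj /rV0Pn[i0 ui0]; apply: contra_notP s_nonpoly => none.
pose l := [seq (t i, fun x => u 0 i * s x) | i <- enum 'I_k & i != i0].
have rel lam b :
    u 0 i0 * s (lam * t i0 + b) + \sum_(c <- l) c.2 (lam * c.1 + b) = 0.
  rewrite big_map big_filter big_enum_cond /=.
  apply/eqP/negPn/negP => ne0; apply: none; exists lam, b.
  by rewrite (bigD1 i0).
have lt0 : all (fun c : R * (R -> R) => c.1 != t i0) l.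
  apply/allP => c /mapP[i]; rewrite mem_filter => /andP[ii0 _] -> /=.
  by apply: contraNneq ii0 => /tinj ->.
have gc : continuous (fun x => u 0 i0 * s x).
  by move=> x; apply: cvgM; [exact: cvg_cst|exact: s_cont].
have [p ps] := polynomial_of_iter_fdiff gc
  (fun h x => iter_fdiff_of_relation h x lt0 rel).
by exists ((u 0 i0)^-1 *: p) => x; rewrite hornerZ -ps mulKf.
Qed.

(** Hidden units are chosen greedily: while there are fewer than [k], some nonzero [u] is orthogonal
    to all their value vectors, and a unit not orthogonal to [u] lies outside their span. *)
Lemma ridge_unitmx k (t : 'I_k -> R) : injective t ->
  exists lam b : 'rV[R]_k,
    (\matrix_(i, j) s (lam 0 j * t i + b 0 j)) \in unitmx.
Proof.
move=> tinj.
pose M r (lam b : 'rV[R]_r) : 'M_(r, k) :=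
  \matrix_(j, i) s (lam 0 j * t i + b 0 j).
have ex r : (r <= k)%N -> exists lam b : 'rV[R]_r, row_free (M r lam b).
  elim: r => [|r IH] rk.
    by exists 0, 0; rewrite /row_free -leqn0 rank_leq_row.
  have [lam [b fr]] := IH (ltnW rk).
  have /rowV0Pn[u uM u0] : kermx (M r lam b)^T != 0.
    by rewrite -mxrank_eq0 mxrank_ker mxrank_tr (eqP fr) subn_eq0 -ltnNge.
  have [l0 [b0 ne0]] := ridge_separates tinj u0.
  exists (row_mx (l0%:M : 'rV_1) lam), (row_mx (b0%:M : 'rV_1) b).
  pose v : 'rV_k := \row_i s (l0 * t i + b0).
  have -> : M (1 + r)%N (row_mx l0%:M lam) (row_mx b0%:M b) = col_mx v (M r lam b).
    apply/matrixP => j i; rewrite !mxE.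
    by case: splitP => j' _; rewrite !mxE ?ord1 ?eqxx ?mulr1n.
  have vM : ~~ (v <= M r lam b)%MS.
    apply: contraNN ne0 => /submxP[z vz].
    have : v *m u^T = 0.
      by rewrite vz -mulmxA -[M r lam b]trmxK -trmx_mul (sub_kermxP uM) trmx0 mulmx0.
    move/matrixP/(_ 0 0); rewrite !mxE => E; apply/eqP; rewrite -[RHS]E.
    by apply: eq_bigr => i _; rewrite !mxE mulrC.
  have rkE : \rank (v + M r lam b)%MS = \rank (col_mx v (M r lam b)).
    by rewrite addsmxE.
  rewrite /row_free -rkE eqn_leq.
  rewrite (leq_trans (mxrank_adds_leqif _ _)) /=; last first.
    by rewrite -[r.+1]/(1 + r)%N leq_add // rank_leq_row.
  have : (M r lam b < v + M r lam b)%MS.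
    rewrite ltmxE addsmxSr /=; apply: contraNN vM.
    exact: submx_trans (addsmxSl _ _).
  by move/rank_ltmx; rewrite (eqP fr).
have [lam [b fr]] := ex k (leqnn k); exists lam, b.
rewrite -unitmx_tr -row_free_unit.
suff -> : (\matrix_(i, j) s (lam 0 j * t i + b 0 j))^T = M k lam b by [].
by apply/matrixP => i j; rewrite !mxE.
Qed.

(** Take [w = (1, c, c^2, ...)]: each nonzero difference of points is the coefficient vector of a
    nonzero polynomial in [c], and [c] only has to avoid the finitely many roots. *)
Lemma separating_form p (xs : seq 'rV[R]_p) :
  exists w : 'cV[R]_p, {in xs &, injective (fun x => (x *m w) 0 0)}.
Proof.
(* [insub] turns the natural index into an ordinal; as [i < p], the default [0] never occurs. *)
pose P (z : 'rV[R]_p) : {poly R} := \poly_(i < p) (if insub i is Some j then z 0 j else 0).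
have P0 z : z != 0 -> P z != 0.
  case/rV0Pn => j zj; apply: contraNneq zj => /polyP/(_ j).
  by rewrite coef_poly ltn_ord valK coef0 => ->.
pose ds := [seq z <- [seq x - y | x <- xs, y <- xs] | z != 0].
pose Q := \prod_(z <- ds) P z.
have Q0 : Q != 0.
  rewrite prodf_seq_neq0; apply/allP => z; rewrite mem_filter => /andP[z0 _].
  exact: P0.
have [c Qc] : exists c, ~~ root Q c.
  apply: contrapT => all0.
  pose ns : seq R := [seq i%:R | i <- iota 0 (size Q)].
  have rts : all (root Q) ns.
    by apply/allP => c _; apply/negPn/negP => rc; apply: all0; exists c.
  have uns : uniq ns.
    by rewrite map_inj_uniq ?iota_uniq // => i j /eqP; rewrite eqr_nat => /eqP.
  by have := max_poly_roots Q0 rts uns; rewrite size_map size_iota ltnn.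
exists (\col_i c ^+ i) => x y xxs yxs exy.
apply/eqP/negPn/negP; rewrite -subr_eq0 => xy0.
move: Qc; rewrite rootE horner_prod prodf_seq_eq0 => /hasP; apply.
exists (x - y).
  by rewrite mem_filter xy0; apply/allpairsP; exists (x, y).
rewrite /= horner_poly.
have -> : \sum_(i < p) (if insub (i : nat) is Some j then (x - y) 0 j else 0) * c ^+ i =
   ((x - y) *m \col_(i < p) c ^+ i) 0 0.
  by rewrite mxE; apply: eq_bigr => i _; rewrite valK !mxE.
by rewrite mulmxBl !mxE; move: exy; rewrite !mxE => ->; rewrite subrr.
Qed.

(** After an injective projection to the line, the hidden activations at the distinct points form an
    invertible matrix [M]; the output weights solve the resulting linear system. *)
Lemma mlp_interpolation p q (xs : seq 'rV[R]_p) (g : 'rV[R]_p -> 'rV[R]_q) :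
  exists f : mlp R p q, {in xs, forall x, mlp_eval s f x = g x}.
Proof.
have [w winj] := separating_form xs.
pose ys := undup xs; pose k := size ys.
pose t (i : 'I_k) := (nth 0 ys i *m w) 0 0.
have memy i : (i < k)%N -> nth 0 ys i \in xs.
  by move=> ik; rewrite -mem_undup mem_nth.
have tinj : injective t.
  move=> i j /(winj _ _ (memy _ (ltn_ord i)) (memy _ (ltn_ord j)))/eqP.
  by rewrite nth_uniq ?undup_uniq // => /eqP/val_inj.
have [lam [b]] := ridge_unitmx tinj.
set M := \matrix_(_, _) _ => Mu.
pose G : 'M_(k, q) := \matrix_i g (nth 0 ys i).
exists (mlp_layer (w *m lam) b (mlp_affine (invmx M *m G) 0)) => x xxs.
have xi : (index x ys < k)%N by rewrite index_mem mem_undup.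
pose i := Ordinal xi.
have xE : x = nth 0 ys i by rewrite nth_index // mem_undup.
rewrite /= addr0.
have -> : map_mx s (x *m (w *m lam) + b) = row i M.
  apply/rowP => j; rewrite mulmxA !mxE big_ord1 mulrC {1}xE; congr (s (_ * _ + _)).
by rewrite -row_mul mulmxA mulmxV // mul1mx rowK -xE.
Qed.

End Interpolation.

(** * Finiteness of the set of simple graphs *)

Section SimpleAdjacency.
Variables (R : realType) (n : nat).

Lemma simple_adj_map_bool (X : 'M[R]_n) : simple_adj X ->
  exists B : 'M[bool]_n, X = map_mx (fun b : bool => b%:R) B.
Proof.
case=> _ [X01 _]; exists (map_mx (fun x => x == 1) X).
apply/matrixP => i j; rewrite !mxE.
by case: (X01 i j) => ->; rewrite ?eqxx // eq_sym oner_eq0.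
Qed.

Lemma simple_adj_values (T : finType) (V : choiceType) (v : 'M[R]_n -> T -> V) :
  exists xs : seq V, forall X, simple_adj X -> forall t, v X t \in xs.
Proof.
exists [seq v (map_mx (fun b : bool => b%:R) B) t | B <- enum 'M[bool]_n, t <- enum T].
move=> X /simple_adj_map_bool[B ->] t; apply/allpairsP.
by exists (B, t); rewrite !mem_enum.
Qed.

End SimpleAdjacency.

(** * Matrix functions computed exactly by PPGN++ *)

Section PPGN.
Variables (R : realType) (s : R -> R) (n : nat).
Hypotheses (s_cont : continuous s) (s_nonpoly : ~ is_polynomial_fun s).

Definition tens_map p q (g : bool -> 'rV[R]_p -> 'rV[R]_q) (Z : tens R n p)
  : tens R n q := fun i j => g (i == j) (Z i j).

Lemma mlp2_interpolation p q (Z : 'M[R]_n -> tens R n p) g :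
  exists m : mlp2 R p q, forall X, simple_adj X ->
    mlp2_apply s m (Z X) = tens_map g (Z X).
Proof.
have [xs Zxs] := simple_adj_values (fun X (t : 'I_n * 'I_n) => Z X t.1 t.2).
have [md mdE] := mlp_interpolation s_cont s_nonpoly xs (g true).
have [mo moE] := mlp_interpolation s_cont s_nonpoly xs (g false).
exists (md, mo) => X sX; apply/funext => i; apply/funext => j.
have := Zxs X sX (i, j); rewrite /mlp2_apply /tens_map /=.
by case: eqP => _ Zij; rewrite ?mdE ?moE.
Qed.

(* [Z] is the tensor produced by some stack of layers: every continuation [N]
   can be prefixed by a network computing [Z] exactly on simple graphs. *)
Definition pp_feature d (Z : 'M[R]_n -> tens R n d) : Prop :=
  (exists c, forall X i j, Z X i j 0 c = X i j) /\
  forall N : ppgn R d, exists N0 : ppgn R 1,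
    forall X, simple_adj X -> ppgn_eval s N0 X = ppgn_run s N (Z X).

(** A single layer: [a1] and [a2] prepare the factors of the matrix product, [be] acts after it, and
    the skip connection preserves all old channels. *)
Lemma pp_feature_append d (Z : 'M[R]_n -> tens R n d)
    (a1 : bool -> 'rV[R]_d -> 'rV[R]_d -> R) (a2 : bool -> 'rV[R]_d -> R)
    (be : bool -> R -> 'rV[R]_d -> R) :
  pp_feature Z ->
  pp_feature (fun X i j => row_mx
    (be (i == j) (\sum_k a1 (i == k) (Z X i k) (Z X k i) * a2 (k == j) (Z X k j))
       (Z X i j))%:M (Z X i j) : 'rV_(1 + d)).
Proof.
case=> -[c Zc] ZN; split.
  by exists (rshift 1 c) => X i j; rewrite row_mxEr Zc.
move=> N.
pose g1 b (v : 'rV[R]_(d + d)) : 'rV_1 := (a1 b (lsubmx v) (rsubmx v))%:M.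
pose g2 b (v : 'rV[R]_d) : 'rV_1 := (a2 b v)%:M.
pose g3 b (v : 'rV[R]_(1 + d)) : 'rV_(1 + d) :=
  row_mx (be b (lsubmx v 0 0) (rsubmx v))%:M (rsubmx v).
have [m1 m1E] := mlp2_interpolation (fun X => tens_cat (Z X) (tens_tr (Z X))) g1.
have [m2 m2E] := mlp2_interpolation Z g2.
have [m3 m3E] := mlp2_interpolation (fun X => tens_cat
  (tens_mul (tens_map g1 (tens_cat (Z X) (tens_tr (Z X)))) (tens_map g2 (Z X)))
  (Z X)) g3.
have [N0 N0E] := ZN (pp_layer m1 m2 m3 N).
exists N0 => X sX; rewrite N0E //= m1E // m2E // m3E //; congr (ppgn_run s N _).
apply/funext => i; apply/funext => j.
rewrite /tens_map /g3 /tens_cat row_mxKl row_mxKr; congr (row_mx (be _ _ _)%:M _).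
rewrite mxE; apply: eq_bigr => k _.
by rewrite /g1 /g2 /tens_tr row_mxKl row_mxKr !mxE eqxx !mulr1n.
Qed.

(** Computability is the ability to extend any given stack without losing its channels, so that
    several computable functions can be placed in one tensor. *)
Definition pp_computable (F : 'M[R]_n -> 'M[R]_n) : Prop :=
  forall d (Z : 'M[R]_n -> tens R n d), pp_feature Z ->
  exists d' (Z' : 'M[R]_n -> tens R n d'),
    [/\ pp_feature Z',
        forall c, exists c', forall X i j, Z' X i j 0 c' = Z X i j 0 c
      & exists c', forall X i j, Z' X i j 0 c' = F X i j].

Lemma pp_computable_id : pp_computable id.
Proof.
by move=> d Z ZF; exists d, Z; split => //; [move=> c; exists c|case: ZF].
Qed.

Lemma pp_computable_layer (F G H : 'M[R]_n -> 'M[R]_n) (a1 : bool -> R * R -> R * R -> R)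
    (a2 : bool -> R * R -> R) (be : bool -> R -> R * R -> R) :
  pp_computable F -> pp_computable G ->
  (forall X i j, H X i j =
     be (i == j) (\sum_k a1 (i == k) (F X i k, G X i k) (F X k i, G X k i) *
                         a2 (k == j) (F X k j, G X k j)) (F X i j, G X i j)) ->
  pp_computable H.
Proof.
move=> cF cG HE d Z /cF[d1 [Z1 [/cG[d2 [Z2 [Z2f Z12 [cg Z2g]]]] ZZ1 [c1 Z1f]]]].
have [cf Z2F] := Z12 c1.
pose pr (v : 'rV[R]_d2) := (v 0 cf, v 0 cg).
have prE X i j : pr (Z2 X i j) = (F X i j, G X i j) by rewrite /pr Z2F Z1f Z2g.
have := pp_feature_append (fun b u v => a1 b (pr u) (pr v))
  (fun b u => a2 b (pr u)) (fun b x u => be b x (pr u)) Z2f.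
set Z3 := (X in pp_feature X) => Z3f.
exists (1 + d2)%N, Z3; split=> // [c|].
  have [c' c'E] := ZZ1 c; have [c'' c''E] := Z12 c'.
  by exists (rshift 1 c'') => X i j; rewrite row_mxEr c''E c'E.
exists (lshift d2 0) => X i j; rewrite row_mxEl mxE eqxx mulr1n HE prE.
by congr be; apply: eq_bigr => k _; rewrite !prE.
Qed.

Lemma pp_computable_mul F G : pp_computable F -> pp_computable G ->
  pp_computable (fun X => F X *m G X).
Proof.
move=> cF cG; apply: (pp_computable_layer (a1 := fun _ u _ => u.1)
  (a2 := fun _ u => u.2) (be := fun _ x _ => x) cF cG) => X i j.
by rewrite mxE.
Qed.

Lemma pp_computable_entrywise F G (phi : bool -> R -> R -> R) :
  pp_computable F -> pp_computable G ->
  pp_computable (fun X => \matrix_(i, j) phi (i == j) (F X i j) (G X i j)).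
Proof.
move=> cF cG; apply: (pp_computable_layer (a1 := fun _ _ _ => 0)
  (a2 := fun _ _ => 0) (be := fun b _ u => phi b u.1 u.2) cF cG) => X i j.
by rewrite mxE.
Qed.

(** A layer offers the transpose only to the left factor; multiplying by the identity matrix
    extracts it. *)
Lemma pp_computable_tr F : pp_computable F -> pp_computable (fun X => (F X)^T).
Proof.
move=> cF; apply: (pp_computable_layer (a1 := fun _ _ u => u.1)
  (a2 := fun b _ => b%:R) (be := fun _ x _ => x) cF cF) => X i j /=.
rewrite mxE (bigD1 j) //= eqxx mulr1 big1 ?addr0 // => k /negPf ->.
by rewrite mulr0.
Qed.

Lemma pp_computable_const (c : R) : pp_computable (fun=> const_mx c).
Proof.
apply: (pp_computable_layer (a1 := fun _ _ _ => 0) (a2 := fun _ _ => 0)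
  (be := fun _ _ _ => c) pp_computable_id pp_computable_id) => X i j.
by rewrite mxE.
Qed.

Lemma pp_computable_hadamard F G : pp_computable F -> pp_computable G ->
  pp_computable (fun X => \matrix_(i, j) (F X i j * G X i j)).
Proof. exact: (@pp_computable_entrywise F G (fun _ x y => x * y)). Qed.

(** The all-ones matrix times the diagonal part of [F X] spreads each diagonal entry over its
    column. *)
Lemma pp_computable_diag_col F : pp_computable F ->
  pp_computable (fun X => \matrix_(i, j) F X j j).
Proof.
move=> cF; apply: (pp_computable_layer (a1 := fun _ _ _ => 1)
  (a2 := fun b u => if b then u.1 else 0) (be := fun _ x _ => x) cF cF) => X i j /=.
rewrite mxE (bigD1 j) //= eqxx mul1r big1 ?addr0 // => k /negPf ->.
by rewrite mulr0.
Qed.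

Lemma pp_computable_diag_row F : pp_computable F ->
  pp_computable (fun X => \matrix_(i, j) F X i i).
Proof.
move=> /pp_computable_diag_col/pp_computable_tr.
by congr pp_computable; apply/funext => X; apply/matrixP => i j; rewrite !mxE.
Qed.

Lemma pp_computable_network F : pp_computable F ->
  exists N : ppgn R 1, forall X, simple_adj X -> ppgn_eval s N X = F X.
Proof.
pose Z0 (X : 'M[R]_n) : tens R n 1 := fun i j => (X i j)%:M.
have Z0f : pp_feature Z0.
  split; last by move=> N; exists N.
  by exists 0 => X i j; rewrite mxE eqxx mulr1n.
move=> /(_ _ _ Z0f)[d [Z [[_ Zf] _ [c ZF]]]].
have [N NE] := Zf (pp_out R c); exists N => X sX; rewrite NE //=.
by apply/matrixP => i j; rewrite mxE ZF.
Qed.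

End PPGN.

(** * Node functions computed exactly by MPNN *)

Section MPNN.
Variables (R : realType) (s : R -> R) (n : nat).
Hypotheses (s_cont : continuous s) (s_nonpoly : ~ is_polynomial_fun s).

Definition mp_feature d (Y : 'M[R]_n -> 'M[R]_(n, d)) : Prop :=
  forall N : mpnn R d, exists N0 : mpnn R 1,
    forall X, simple_adj X -> mpnn_eval s N0 X = mpnn_run s X N (Y X).

Lemma mp_feature_append d (Y : 'M[R]_n -> 'M[R]_(n, d))
    (be : 'rV[R]_d -> 'rV[R]_d -> 'rV[R]_d -> R) :
  mp_feature Y ->
  mp_feature (fun X => row_mx
    (\col_i be (row i (X *m Y X)) (row i (const_mx 1 *m Y X)) (row i (Y X)))
    (Y X) : 'M_(n, 1 + d)).
Proof.
move=> YN N.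
pose g (v : 'rV[R]_(d + d + d)) : 'rV_(1 + d) :=
  row_mx (be (lsubmx (lsubmx v)) (rsubmx (lsubmx v)) (rsubmx v))%:M (rsubmx v).
pose w (X : 'M[R]_n) := row_mx (row_mx (X *m Y X) ((const_mx 1 : 'M[R]_(n, n)) *m Y X)) (Y X).
have [xs wxs] := simple_adj_values (fun X i => row i (w X)).
have [m mE] := mlp_interpolation s_cont s_nonpoly xs g.
have [N0 N0E] := YN (mp_layer m N).
exists N0 => X sX; rewrite N0E //=; congr (mpnn_run s X N _).
apply/row_matrixP => i; rewrite rowK mE ?wxs // /w /g !row_row_mx.
rewrite !row_mxKl !row_mxKr; congr row_mx.
by apply/rowP => j; rewrite !mxE ord1 mulr1n.
Qed.

(** The same extension property as [pp_computable], for node features. *)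
Definition mp_computable (F : 'M[R]_n -> 'I_n -> R) : Prop :=
  forall d (Y : 'M[R]_n -> 'M[R]_(n, d)), mp_feature Y ->
  exists d' (Y' : 'M[R]_n -> 'M[R]_(n, d')),
    [/\ mp_feature Y',
        forall c, exists c', forall X i, Y' X i c' = Y X i c
      & exists c', forall X i, Y' X i c' = F X i].

Lemma mp_computable_const (c : R) : mp_computable (fun _ _ => c).
Proof.
move=> d Y Yf; have := mp_feature_append (fun _ _ _ => c) Yf.
set Y' := (X in mp_feature X) => Y'f; exists (1 + d)%N, Y'; split=> // [k|].
  by exists (rshift 1 k) => X i; rewrite row_mxEr.
by exists (lshift d 0) => X i; rewrite row_mxEl mxE.
Qed.

Lemma mp_computable_layer (F G H : 'M[R]_n -> 'I_n -> R) (be : R -> R -> R -> R -> R) :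
  mp_computable F -> mp_computable G ->
  (forall X i, H X i =
     be (\sum_j X i j * F X j) (\sum_j F X j) (F X i) (G X i)) ->
  mp_computable H.
Proof.
move=> cF cG HE d Y /cF[d1 [Y1 [/cG[d2 [Y2 [Y2f Y12 [cg Y2g]]]] YY1 [c1 Y1f]]]].
have [cf Y2F] := Y12 c1.
have := mp_feature_append (fun u v w => be (u 0 cf) (v 0 cf) (w 0 cf) (w 0 cg)) Y2f.
set Y3 := (X in mp_feature X) => Y3f.
exists (1 + d2)%N, Y3; split=> // [c|].
  have [c' c'E] := YY1 c; have [c'' c''E] := Y12 c'.
  by exists (rshift 1 c'') => X i; rewrite row_mxEr c''E c'E.
exists (lshift d2 0) => X i; rewrite row_mxEl !mxE HE Y2F Y1f Y2g.
by congr be; apply: eq_bigr => k _; rewrite ?mxE ?mul1r Y2F Y1f.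
Qed.

Lemma mp_computable_mul F G : mp_computable F -> mp_computable G ->
  mp_computable (fun X i => F X i * G X i).
Proof.
by move=> cF cG; apply: (mp_computable_layer (be := fun _ _ x y => x * y) cF cG).
Qed.

Lemma mp_computable_neighbours F : mp_computable F ->
  mp_computable (fun X i => \sum_j X i j * F X j).
Proof.
by move=> cF; apply: (mp_computable_layer (be := fun x _ _ _ => x) cF cF).
Qed.

Lemma mp_computable_total F : mp_computable F ->
  mp_computable (fun X _ => \sum_j F X j).
Proof.
by move=> cF; apply: (mp_computable_layer (be := fun _ x _ _ => x) cF cF).
Qed.

Lemma mp_computable_network F : mp_computable F ->
  exists N : mpnn R 1, forall X, simple_adj X -> mpnn_eval s N X = F X.
Proof.
have Y0f : mp_feature (fun=> const_mx 1 : 'M[R]_(n, 1)) by move=> N; exists N.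
move=> /(_ _ _ Y0f)[d [Y [Yf _ [c YF]]]].
have [N NE] := Yf (mp_out R c); exists N => X sX; rewrite NE //=.
by apply/funext => i; rewrite YF.
Qed.

End MPNN.

(** * Variable elimination and degree counting in labelled patterns *)

Section FactorGraphs.
Variables (R : realType) (n : nat) (V : finType).
Implicit Types (X : 'M[R]_n) (f env : {ffun V -> 'I_n}) (A B : {set V}) (u v w : V).

(* An edge [(r, q)] of the pattern labelled by a matrix-valued function of the
   adjacency matrix; the patterns of the paper carry the label [id]. *)
Definition factor := (V * V * ('M[R]_n -> 'M[R]_n))%type.
Implicit Types (e : factor) (E : seq factor).

Definition weight E X f : R := \prod_(e <- E) e.2 X (f e.1.1) (f e.1.2).

(** [A] holds the vertices still to be summed out; the others are frozen at [env]. Elimination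
    shrinks [A] and keeps the vertex type. *)
Definition agree_off A env f := [forall u, (u \notin A) ==> (f u == env u)].

Definition marginal A E X env : R := \sum_(f | agree_off A env f) weight E X f.

Definition upd f v (x : 'I_n) : {ffun V -> 'I_n} :=
  [ffun u => if u == v then x else f u].

Lemma upd_eq f v x : upd f v x v = x.
Proof. by rewrite ffunE eqxx. Qed.

Lemma upd_neq f v x u : u != v -> upd f v x u = f u.
Proof. by rewrite ffunE => /negPf ->. Qed.

Lemma sum_agree_off_upd A v env (g : {ffun V -> 'I_n} -> R) : v \in A ->
  \sum_(f | agree_off A env f) g f =
  \sum_(f | agree_off (A :\ v) env f) \sum_x g (upd f v x).
Proof.
move=> vA; rewrite pair_big /=.
(* An assignment corresponds to its value at [v] together with itself reset to [env v] at [v]. *)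
rewrite (reindex_onto (fun p : {ffun V -> 'I_n} * 'I_n => upd p.1 v p.2)
  (fun f => (upd f v (env v), f v))) /=; last first.
  move=> f _; apply/ffunP => u; rewrite !ffunE.
  by case: eqVneq => [->|].
apply: eq_bigl => -[f x] /=; rewrite andbT upd_eq xpair_eqE eqxx andbT.
apply/andP/forallP => [[/forallP agr /eqP fE] u|agr].
  apply/implyP; rewrite !inE negb_and negbK => uA; rewrite -fE.
  have [->|uv] := eqVneq u v; first by rewrite upd_eq.
  rewrite !upd_neq //; have := implyP (agr u); rewrite upd_neq //; apply.
  by move: uA; rewrite (negPf uv).
split.
  apply/forallP => u; apply/implyP => uA.
  have uv : u != v by apply: contraNneq uA => ->.
  by rewrite upd_neq //; apply: (implyP (agr u)); rewrite !inE negb_and uA orbT.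
apply/eqP/ffunP => u; have [->|uv] := eqVneq u v; last by rewrite !upd_neq.
by rewrite upd_eq; apply/esym/eqP/(implyP (agr v)); rewrite !inE eqxx.
Qed.

Definition incident v e := (e.1.1 == v) || (e.1.2 == v).

(** Distributivity: factors not incident to [v] are constant in [x] and leave the inner sum. *)
Lemma marginal_elim A v env E E' X : v \in A ->
  (forall f, \sum_x weight [seq e <- E | incident v e] X (upd f v x) =
             weight E' X f) ->
  marginal A E X env =
  marginal (A :\ v) (E' ++ [seq e <- E | ~~ incident v e]) X env.
Proof.
move=> vA E'E; rewrite /marginal (sum_agree_off_upd _ _ vA).
apply: eq_bigr => f _; rewrite {2}/weight big_cat /= -!/(weight _ _ _) -E'E.
rewrite mulr_suml; apply: eq_bigr => x _.
rewrite /weight (bigID (incident v)) /= !big_filter; congr (_ * _).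
apply: eq_bigr => e; rewrite /incident negb_or => /andP[e1 e2].
by rewrite !upd_neq.
Qed.

Lemma marginal_set0 E X env : marginal set0 E X env = weight E X env.
Proof.
rewrite /marginal (big_pred1 env) // => f; apply/forallP/eqP => [agr|-> u].
  by apply/ffunP => u; apply/eqP/(implyP (agr u)); rewrite inE.
by rewrite eqxx implybT.
Qed.

Definition nbr E v : {set V} :=
  [set u | (u != v) && has (fun e => (e.1 == (u, v)) || (e.1 == (v, u))) E].

(** Loops are left out because they act as vertex weights and create no neighbours. *)
Definition links E := count (fun e => e.1.1 != e.1.2) E.

Definition supported A E := all (fun e => (e.1.1 \in A) && (e.1.2 \in A)) E.

Lemma nbr_sub A E v : supported A E -> nbr E v \subset A :\ v.
Proof.
move=> EA; apply/subsetP => u; rewrite !inE => /andP[-> /=].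
elim: E EA => //= e E IH /andP[/andP[e1 e2] /IH{}IH] /orP[|/IH //].
by case/orP => /eqP E'; move: e1 e2; rewrite E'.
Qed.

Lemma nbr_sym E u v : (u \in nbr E v) = (v \in nbr E u).
Proof.
by rewrite !inE eq_sym; congr (_ && _); apply: eq_has => e; rewrite orbC.
Qed.

(** Handshake bound: a non-loop edge gives each endpoint at most one new neighbour. *)
Lemma sum_card_nbr E A : (\sum_(v in A) #|nbr E v| <= 2 * links E)%N.
Proof.
elim: E => [|e E IH].
  by rewrite big1 // => v _; apply/eqP; rewrite cards_eq0 -subset0;
    apply/subsetP => u; rewrite !inE andbF.
have sum1 (x : V) : (\sum_(v in A) (v == x : nat) <= 1)%N.
  rewrite (leq_trans (n := \sum_v (v == x : nat))) //.
    by rewrite [leqRHS](bigID (mem A)) leq_addr.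
  by rewrite (bigD1 x) //= eqxx big1 ?addn0 // => v /negPf ->.
pose l : nat := e.1.1 != e.1.2.
have le v : (#|nbr (e :: E) v| <= #|nbr E v| + l * ((v == e.1.1) + (v == e.1.2)))%N.
  (* The neighbours that [e] contributes to [v]: at most one vertex. *)
  pose D : {set V} := [set u | (e.1.1 != e.1.2) &&
    ((v == e.1.1) && (u == e.1.2) || (v == e.1.2) && (u == e.1.1))].
  apply: (@leq_trans #|nbr E v :|: D|).
    apply/subset_leq_card/subsetP => u; rewrite !inE /=.
    case/andP => uv /orP[|->]; last by rewrite uv.
    case: e @l @D => -[r q] M /=; rewrite !xpair_eqE.
    case/orP => /andP[/eqP-> /eqP->]; rewrite !eqxx /= ?orbT ?andbT;
      by rewrite ?uv ?orbT // eq_sym uv orbT.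
  rewrite cardsU (leq_trans (leq_subr _ _)) // leq_add2l /l.
  have [re|re] /= := eqVneq e.1.1 e.1.2.
    by rewrite mul0n leqn0 cards_eq0 -subset0; apply/subsetP => u; rewrite !inE re eqxx.
  have [ve|ve] := eqVneq v e.1.1.
    rewrite mul1n ve (negPf re) addn0 /= -[leqRHS](cards1 e.1.2); apply/subset_leq_card/subsetP => u.
    by rewrite !inE ve eqxx (negPf re) orbF => /andP[].
  have [ve2|ve2] := eqVneq v e.1.2.
    rewrite mul1n add0n /= -[leqRHS](cards1 e.1.1); apply/subset_leq_card/subsetP => u.
    by rewrite !inE (negPf ve) => /andP[_ /andP[]].
  rewrite leqn0 cards_eq0 -subset0; apply/subsetP => u.
  by rewrite !inE (negPf ve) (negPf ve2) andbF.
apply: (@leq_trans (\sum_(v in A)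
  (#|nbr E v| + l * ((v == e.1.1) + (v == e.1.2)))%N)).
  by apply: leq_sum => v _; apply: le.
rewrite big_split /= -big_distrr big_split /= /links /= -/l.
rewrite [leqRHS]mulnDr addnC; apply: leq_add => //.
rewrite [leqRHS]mulnC leq_mul2l; apply/orP; right.
by rewrite -[2%N]/(1 + 1)%N leq_add.
Qed.

(* If every vertex of A has more than t neighbours, then A :|: B has at least
   t + 2 vertices; if it has exactly t + 2, every vertex of A is adjacent to all
   others, in particular to every vertex of B. *)
Lemma low_degree_vertex A B E t : [disjoint A & B] -> supported (A :|: B) E ->
  A != set0 -> (#|B| <= t.+1)%N ->
  (2 * links E < t.+1 * (t.+3 - #|B|))%N ->
  (2 * links E < (t.+1 + #|B|) * (t.+2 - #|B|))%N ->
  exists2 v, v \in A & (#|nbr E v| <= t)%N.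
Proof.
move=> dAB EAB A0 Bt big tight; apply/exists_inP; apply: contraT.
rewrite negb_exists_in => /forall_inP high.
have {}high v : v \in A -> (t < #|nbr E v|)%N by move/high; rewrite -ltnNge.
have cAB : #|A :|: B| = (#|A| + #|B|)%N.
  by rewrite cardsU disjoint_setI0 // cards0 subn0.
have nbr_le v : v \in A -> (#|nbr E v| <= #|A| + #|B| - 1)%N.
  move=> vA; have := subset_leq_card (nbr_sub v EAB).
  by have := cardsD1 v (A :|: B); rewrite cAB inE vA /=; lia.
have AB : (t.+2 <= #|A| + #|B|)%N.
  by have [v vA] := set0Pn _ A0; have := high v vA; have := nbr_le v vA; lia.
have sumA : (t.+1 * #|A| <= \sum_(v in A) #|nbr E v|)%N.
  by rewrite mulnC -sum_nat_const; apply: leq_sum => v /high.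
have [ABt|ABt] := eqVneq (#|A| + #|B|)%N t.+2; last first.
  (* With at least [t + 3] vertices in all, the degrees in [A] alone contradict [big]. *)
  have := sum_card_nbr E A.
  have : (t.+1 * (t.+3 - #|B|) <= t.+1 * #|A|)%N by rewrite leq_mul2l; lia.
  lia.
have sumB : (#|B| * #|A| <= \sum_(v in B) #|nbr E v|)%N.
  rewrite -sum_nat_const; apply: leq_sum => w wB.
  apply/subset_leq_card/subsetP => v vA; rewrite nbr_sym.
  have /eqP -> : nbr E v == (A :|: B) :\ v.
    rewrite eqEcard nbr_sub //=; have := high v vA.
    by have := cardsD1 v (A :|: B); rewrite cAB inE vA /=; lia.
  rewrite !inE wB orbT andbT; apply: contraTneq vA => <-.
  by rewrite (disjointFl dAB wB).
have := sum_card_nbr E (A :|: B).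
rewrite (eq_bigl [predU A & B]); last by move=> v; rewrite !inE.
rewrite bigU //=.
have cA : (t.+2 - #|B| = #|A|)%N by lia.
by move: tight; rewrite cA mulnDl; lia.
Qed.

Lemma incident_supported E v :
  supported (v |: nbr E v) [seq e <- E | incident v e].
Proof.
rewrite /supported all_filter.
(* Only endpoints matter here, so membership in [E] is expressed through the endpoint pair, ignoring
   the function that labels it. *)
have sub : subpred (fun e => has (fun e' => (e'.1 == e.1)) E) 
  (fun e => incident v e ==> (e.1.1 \in v |: nbr E v) && (e.1.2 \in v |: nbr E v)).
  case=> -[r q] M /= eE; apply/implyP; rewrite /incident /= !inE; move: eE.
  have [->|rv] := eqVneq r v; have [->|qv] := eqVneq q v => //= eE _; rewrite ?andbT.
    by apply: sub_has eE => e /eqP -> /=; rewrite eqxx orbT.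
  by apply: sub_has eE => e /eqP -> /=; rewrite eqxx.
apply: (sub_all sub).
rewrite -(all_map fst (fun p => has (fun e' : factor => e'.1 == p) E)).
by apply/allP => p pE; rewrite -(has_map fst (pred1 p)) has_pred1.
Qed.

Lemma supported_elim A B v E E' : [disjoint A & B] -> v \in A ->
  supported (A :|: B) E -> supported ((A :|: B) :\ v) E' ->
  supported (A :\ v :|: B) (E' ++ [seq e <- E | ~~ incident v e]).
Proof.
move=> dAB vA EAB E'AB.
have -> : A :\ v :|: B = (A :|: B) :\ v.
  apply/setP => u; rewrite !inE; have [-> /=|//] := eqVneq u v.
  by rewrite (disjointFr dAB vA).
rewrite /supported all_cat [X in X && _]E'AB all_filter.
apply: sub_all EAB => e /= /andP[e1 e2]; apply/implyP.
by rewrite /incident negb_or => /andP[e1v e2v]; rewrite !in_setD1 e1 e2 e1v e2v.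
Qed.

Lemma links_filter (P : pred factor) E : (links [seq e <- E | P e] <= links E)%N.
Proof. by rewrite /links count_filter; apply: sub_count => e /andP[]. Qed.

(** A neighbour witnesses a non-loop edge at [v] that disappears, which pays for the edge that the
    elimination adds. *)
Lemma links_elim E v z : z \in nbr E v ->
  (links [seq e <- E | ~~ incident v e] < links E)%N.
Proof.
rewrite inE => /andP[zv hz].
have split_links : links E =
    (links [seq e <- E | incident v e] + links [seq e <- E | ~~ incident v e])%N.
  rewrite /links; elim: (E) => //= e E' ->.
  by case: (incident v e) => /=; lia.
rewrite split_links -[ltnLHS]add0n ltn_add2r /links count_filter -has_count.
apply: sub_has hz => -[[r q] M] /=; rewrite !xpair_eqE /incident /=.
by case/orP => /andP[/eqP-> /eqP->]; rewrite eqxx ?orbT ?zv // eq_sym zv.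
Qed.

End FactorGraphs.

(** * Elimination of vertices with at most two neighbours by PPGN++ *)

Section PPGNElimination.
Variables (R : realType) (s : R -> R) (n : nat) (V : finType).
Hypotheses (s_cont : continuous s) (s_nonpoly : ~ is_polynomial_fun s).
Implicit Types (A : {set V}) (u v w a b : V) (E : seq (factor R n V)).

Definition pp_labelled E := all (fun e => `[< pp_computable s e.2 >]) E.

(** Edges joining [u] and [v] are oriented from [u] and multiplied entrywise into [F]; those joining
    [v] and [w] go into [G], oriented from [v]. Loops at [v] join [F] as matrices constant along
    columns. Summing over [x] then gives [F X *m G X]. *)
Lemma pp_star_weight E v u w : u != v -> w != v ->
  all (incident v) E -> supported (v |: [set u; w]) E -> pp_labelled E ->
  exists F G : 'M[R]_n -> 'M[R]_n,
    [/\ pp_computable s F, pp_computable s G &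
        forall X f x, weight E X (upd f v x) = F X (f u) x * G X x (f w)].
Proof.
move=> uv wv; elim: E => [|[[r q] M] E IH] /=.
  move=> _ _ _; exists (fun=> const_mx 1), (fun=> const_mx 1).
  split; [exact: pp_computable_const|exact: pp_computable_const|].
  by move=> X f x; rewrite /weight big_nil !mxE mulr1.
move=> /andP[inc incE] /andP[sup supE] /andP[/asboolP cM cE].
have [F [G [cF cG FGE]]] := IH incE supE cE.
have wE X f x : weight ((r, q, M) :: E) X (upd f v x) =
    M X (upd f v x r) (upd f v x q) * (F X (f u) x * G X x (f w)).
  by rewrite /weight big_cons /= -/(weight _ _ _) FGE.
have left N : pp_computable s N ->
    (forall X f x, M X (upd f v x r) (upd f v x q) = N X (f u) x) ->
    exists F G : 'M[R]_n -> 'M[R]_n, [/\ pp_computable s F, pp_computable s G &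
      forall X f x, weight ((r, q, M) :: E) X (upd f v x) =
        F X (f u) x * G X x (f w)].
  move=> cN NE; exists (fun X => \matrix_(i, j) (N X i j * F X i j)), G.
  split=> //; first exact: pp_computable_hadamard.
  by move=> X f x; rewrite wE NE mxE mulrA.
have right N : pp_computable s N ->
    (forall X f x, M X (upd f v x r) (upd f v x q) = N X x (f w)) ->
    exists F G : 'M[R]_n -> 'M[R]_n, [/\ pp_computable s F, pp_computable s G &
      forall X f x, weight ((r, q, M) :: E) X (upd f v x) =
        F X (f u) x * G X x (f w)].
  move=> cN NE; exists F, (fun X => \matrix_(i, j) (N X i j * G X i j)).
  split=> //; first exact: pp_computable_hadamard.
  by move=> X f x; rewrite wE NE mxE mulrCA.
move: inc sup; rewrite /incident /= !inE.
have [rv|rv] := eqVneq r v; have [qv|qv] := eqVneq q v => //= _; last first.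
- rewrite andbT => /orP[]/eqP rE.
    by apply: (left M) => // X f x; rewrite qv upd_eq rE upd_neq.
  apply: (right (fun X => (M X)^T)); first exact: pp_computable_tr.
  by move=> X f x; rewrite mxE qv upd_eq rE upd_neq.
- move=> /orP[]/eqP qE.
    apply: (left (fun X => (M X)^T)); first exact: pp_computable_tr.
    by move=> X f x; rewrite mxE rv upd_eq qE upd_neq.
  by apply: (right M) => // X f x; rewrite rv upd_eq qE upd_neq.
- move=> _; apply: (left (fun X => \matrix_(i, j) M X j j)).
    exact: pp_computable_diag_col.
  by move=> X f x; rewrite mxE rv qv upd_eq.
Qed.

Lemma pp_edge_weight E a b : supported [set a; b] E -> pp_labelled E ->
  exists F : 'M[R]_n -> 'M[R]_n, pp_computable s F /\
    forall X f, weight E X f = F X (f a) (f b).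
Proof.
elim: E => [|[[r q] M] E IH] /=.
  move=> _ _; exists (fun=> const_mx 1); split; first exact: pp_computable_const.
  by move=> X f; rewrite /weight big_nil mxE.
move=> /andP[sup /IH{}IH] /andP[/asboolP cM /IH[F [cF FE]]].
suff [N cN NE] : exists2 N, pp_computable s N &
    forall X (f : {ffun V -> 'I_n}), M X (f r) (f q) = N X (f a) (f b).
  exists (fun X => \matrix_(i, j) (N X i j * F X i j)).
  split=> [|X f]; first exact: pp_computable_hadamard.
  by rewrite /weight big_cons -/(weight _ _ _) /= NE FE mxE.
move: sup; rewrite !inE => /andP[/orP[]/eqP-> /orP[]/eqP->].
- exists (fun X => \matrix_(i, j) M X i i); first exact: pp_computable_diag_row.
  by move=> X f; rewrite mxE.
- by exists M.
- exists (fun X => (M X)^T); first exact: pp_computable_tr.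
  by move=> X f; rewrite mxE.
- exists (fun X => \matrix_(i, j) M X j j); first exact: pp_computable_diag_col.
  by move=> X f; rewrite mxE.
Qed.

Lemma pp_marginal A E a b : [disjoint A & [set a; b]] ->
  supported (A :|: [set a; b]) E -> pp_labelled E ->
  (links E <= 4 + (a == b))%N ->
  exists F : 'M[R]_n -> 'M[R]_n, pp_computable s F /\
    forall X env, marginal A E X env = F X (env a) (env b).
Proof.
have [k] := ubnP #|A|; elim: k A E => // k IH A E Ak dA supE cE lE.
have [A0|A0] := eqVneq A set0.
  rewrite A0 set0U in supE; have [F [cF FE]] := pp_edge_weight supE cE.
  by exists F; split=> // X env; rewrite A0 marginal_set0.
(* For [t = 2] the two bounds read [8 < 9] and [8 < 10] if [a != b], and [10 < 12] twice if
   [a = b]. *)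
have [v vA dv] : exists2 v, v \in A & (#|nbr E v| <= 2)%N.
  apply: (low_degree_vertex dA supE A0); rewrite cards2;
    by case: eqP lE => /= _; lia.
have aA : a \notin A by rewrite (disjointFl dA) // !inE eqxx.
have av : a != v by apply: contraNneq aA => ->.
(* With fewer than two neighbours [u = w], so the new edge is a loop and adds no link; for an
   isolated [v] it is placed at [a]. If [u != w], a neighbour guarantees that a link is removed in
   exchange. *)
have [u [w [nuw [uT wT] luw]]] : exists u w,
    [/\ nbr E v \subset [set u; w],
        u \in (A :|: [set a; b]) :\ v /\ w \in (A :|: [set a; b]) :\ v
      & u != w -> exists z, z \in nbr E v].
  have nT := nbr_sub v supE.
  move: dv; rewrite leq_eqVlt => /orP[/cards2P[u [w [uw nE]]]|].
    exists u, w; split; rewrite ?nE //.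
      by split; apply: (subsetP nT); rewrite nE !inE eqxx ?orbT.
    by move=> _; exists u; rewrite !inE eqxx.
  rewrite ltnS leq_eqVlt => /orP[/cards1P[u nE]|].
    have uT : u \in (A :|: [set a; b]) :\ v.
      by apply: (subsetP nT); rewrite nE !inE.
    by exists u, u; split; rewrite ?nE ?setUid // eqxx.
  rewrite ltnS leqn0 cards_eq0 => /eqP nE.
  have aT : a \in (A :|: [set a; b]) :\ v by rewrite !inE av eqxx orbT.
  by exists a, a; split; rewrite ?nE ?sub0set // eqxx.
have uv : u != v by move: uT; rewrite !inE => /andP[].
have wv : w != v by move: wT; rewrite !inE => /andP[].
pose Ev := [seq e <- E | incident v e].
have [F [G [cF cG FGE]]] : exists F G : 'M[R]_n -> 'M[R]_n,
    [/\ pp_computable s F, pp_computable s G &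
        forall X f x, weight Ev X (upd f v x) = F X (f u) x * G X x (f w)].
  apply: pp_star_weight => //; first exact: filter_all.
    apply: sub_all (incident_supported E v) => e /andP[e1 e2].
    by rewrite !(subsetP (setUS [set v] nuw)).
  by rewrite /pp_labelled all_filter; apply: sub_all cE => e /= ->; rewrite implybT.
pose E' : seq (factor R n V) := [:: (u, w, fun X => F X *m G X)].
have elimE X env : marginal A E X env =
    marginal (A :\ v) (E' ++ [seq e <- E | ~~ incident v e]) X env.
  apply: marginal_elim => // f; rewrite /weight big_cons big_nil mulr1 mxE.
  by apply: eq_bigr => x _; apply: FGE.
have [| | | | |H [cH HE]] := IH (A :\ v) (E' ++ [seq e <- E | ~~ incident v e]).
- by have := cardsD1 v A; rewrite vA; lia.
- by apply: disjointWl dA; rewrite subD1set.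
- by apply: supported_elim => //; rewrite /supported /= uT wT.
- rewrite /pp_labelled /= all_filter; apply/andP; split.
    by apply/asboolP; apply: pp_computable_mul.
  by apply: sub_all cE => e /= ->; rewrite implybT.
- apply: leq_trans lE; rewrite /links /= -/(links _).
  have [_|/luw[z /links_elim]] := eqVneq u w; last by rewrite add1n.
  exact: links_filter.
by exists H; split=> // X env; rewrite elimE.
Qed.

End PPGNElimination.

(** * Elimination of vertices with at most one neighbour by MPNN *)

Section MPNNElimination.
Variables (R : realType) (s : R -> R) (n : nat) (V : finType).
Hypotheses (s_cont : continuous s) (s_nonpoly : ~ is_polynomial_fun s).
Implicit Types (A : {set V}) (u v a : V) (E : seq (factor R n V)).

(* Loops act as vertex weights, so only their diagonal has to be computable. *)
Definition mp_labelled E := all (fun e : factor R n V =>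
  if e.1.1 == e.1.2 then `[< mp_computable s (fun X i => e.2 X i i) >]
  else `[< e.2 = id >]) E.

(** Symmetry makes orientation irrelevant and 0/1 entries collapse parallel edges, so the flag [c]
    records only whether [u] and [v] are joined; loops at [v] go into [h]. *)
Lemma mp_star_weight E v u : u != v ->
  all (incident v) E -> supported [set v; u] E -> mp_labelled E ->
  exists (c : bool) (h : 'M[R]_n -> 'I_n -> R), mp_computable s h /\
    forall X, simple_adj X -> forall f x,
      weight E X (upd f v x) = (if c then X (f u) x else 1) * h X x.
Proof.
move=> uv; elim: E => [|[[r q] M] E IH] /=.
  move=> _ _ _; exists false, (fun _ _ => 1); split; first exact: mp_computable_const.
  by move=> X _ f x; rewrite /weight big_nil mulr1.
move=> /andP[inc incE] /andP[sup supE] /andP[cM cE].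
have [c [h [ch hE]]] := IH incE supE cE.
have wE X f x : simple_adj X -> weight ((r, q, M) :: E) X (upd f v x) =
    M X (upd f v x r) (upd f v x q) * ((if c then X (f u) x else 1) * h X x).
  by move=> sX; rewrite /weight big_cons /= -/(weight _ _ _) hE.
have edge : (forall X f x, simple_adj X ->
      M X (upd f v x r) (upd f v x q) = X (f u) x) ->
    exists (c : bool) (h : 'M[R]_n -> 'I_n -> R), mp_computable s h /\
    forall X, simple_adj X -> forall f x, weight ((r, q, M) :: E) X (upd f v x) =
      (if c then X (f u) x else 1) * h X x.
  move=> ME; exists true, h; split=> // X sX f x; rewrite wE // ME // mulrA.
  case: c {hE wE} => //; rewrite ?mulr1 //.
  by case: sX => _ [/(_ (f u) x)[]-> _]; rewrite !(mul0r, mul1r).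
move: inc sup cM; rewrite /incident /= !inE.
have [rv|rv] := eqVneq r v; have [qv|qv] := eqVneq q v => //= _.
- move=> _; rewrite {1}rv {1}qv eqxx => /asboolP cM.
  exists c, (fun X i => M X i i * h X i); split; first exact: mp_computable_mul.
  by move=> X sX f x; rewrite wE // rv qv upd_eq mulrCA.
- move=> /eqP qE; rewrite {1}rv {1}qE eq_sym (negPf uv) => /asboolP ME; apply: edge.
  by move=> X f x [Xsym _]; rewrite ME rv qE upd_eq upd_neq // Xsym.
- rewrite andbT => /eqP rE; rewrite {1}qv {1}rE (negPf uv) => /asboolP ME; apply: edge.
  by move=> X f x _; rewrite ME qv rE upd_eq upd_neq.
Qed.

Lemma mp_loop_weight E a : supported [set a] E -> mp_labelled E ->
  exists F : 'M[R]_n -> 'I_n -> R, mp_computable s F /\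
    forall X f, weight E X f = F X (f a).
Proof.
elim: E => [|[[r q] M] E IH] /=.
  move=> _ _; exists (fun _ _ => 1); split; first exact: mp_computable_const.
  by move=> X f; rewrite /weight big_nil.
move=> /andP[sup /IH{}IH] /andP[cM /IH[F [cF FE]]].
move: sup cM; rewrite !inE => /andP[/eqP-> /eqP->]; rewrite eqxx => /asboolP cM.
exists (fun X i => M X i i * F X i); split; first exact: mp_computable_mul.
by move=> X f; rewrite /weight big_cons -/(weight _ _ _) FE.
Qed.

Lemma mp_marginal A E a : [disjoint A & [set a]] ->
  supported (A :|: [set a]) E -> mp_labelled E -> (links E <= 2)%N ->
  exists F : 'M[R]_n -> 'I_n -> R, mp_computable s F /\
    forall X, simple_adj X -> forall env, marginal A E X env = F X (env a).
Proof.
have [k] := ubnP #|A|; elim: k A E => // k IH A E Ak dA supE cE lE.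
have [A0|A0] := eqVneq A set0.
  rewrite A0 set0U in supE; have [F [cF FE]] := mp_loop_weight supE cE.
  by exists F; split=> // X _ env; rewrite A0 marginal_set0.
(* For [t = 1] and one frozen vertex, both bounds read [4 < 6]. *)
have [v vA dv] : exists2 v, v \in A & (#|nbr E v| <= 1)%N.
  by apply: (low_degree_vertex dA supE A0); rewrite cards1; lia.
have aA : a \notin A by rewrite (disjointFl dA) // !inE eqxx.
have av : a != v by apply: contraNneq aA => ->.
have [u nu uT] : exists2 u, nbr E v \subset [set u] & u \in (A :|: [set a]) :\ v.
  have nT := nbr_sub v supE.
  move: dv; rewrite leq_eqVlt => /orP[/cards1P[u nE]|].
    by exists u; rewrite ?nE //; apply: (subsetP nT); rewrite nE !inE.
  rewrite ltnS leqn0 cards_eq0 => /eqP nE.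
  by exists a; rewrite ?nE ?sub0set // !inE av eqxx orbT.
have uv : u != v by move: uT; rewrite !inE => /andP[].
pose Ev := [seq e <- E | incident v e].
have [c [h [ch hE]]] : exists (c : bool) (h : 'M[R]_n -> 'I_n -> R),
    mp_computable s h /\ forall X, simple_adj X -> forall f x,
      weight Ev X (upd f v x) = (if c then X (f u) x else 1) * h X x.
  apply: mp_star_weight => //; first exact: filter_all.
    apply: sub_all (incident_supported E v) => e /andP[e1 e2].
    by rewrite !(subsetP (setUS [set v] nu)).
  by rewrite /mp_labelled all_filter; apply: sub_all cE => e /= ->; rewrite implybT.
pose H (X : 'M[R]_n) (i : 'I_n) := \sum_x (if c then X i x else 1) * h X x.
have cH : mp_computable s H.
  rewrite /H; case: (c); first exact: mp_computable_neighbours.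
  have -> : (fun (X : 'M[R]_n) (i : 'I_n) => \sum_x 1 * h X x) =
      (fun X _ => \sum_x h X x).
    by apply/funext => X; apply/funext => i; apply: eq_bigr => x _; rewrite mul1r.
  exact: mp_computable_total.
(* The sum over [v] becomes a weight at [u], encoded as a loop whose diagonal is [H X]. *)
pose E' : seq (factor R n V) := [:: (u, u, fun X => \matrix_(i, j) H X i)].
have elimE X env : simple_adj X -> marginal A E X env =
    marginal (A :\ v) (E' ++ [seq e <- E | ~~ incident v e]) X env.
  move=> sX; apply: marginal_elim => // f; rewrite /weight big_cons big_nil mulr1 mxE.
  by apply: eq_bigr => x _; apply: hE.
have [| | | | |F [cF FE]] := IH (A :\ v) (E' ++ [seq e <- E | ~~ incident v e]).
- by have := cardsD1 v A; rewrite vA; lia.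
- by apply: disjointWl dA; rewrite subD1set.
- by apply: supported_elim => //; rewrite /supported /= uT.
- rewrite /mp_labelled /= eqxx all_filter; apply/andP; split.
    apply/asboolP; suff -> : (fun X i => (\matrix_(i, j) H X i : 'M[R]_n) i i) = H by [].
    by apply/funext => X; apply/funext => i; rewrite mxE.
  by apply: sub_all cE => e /= ->; rewrite implybT.
- by apply: leq_trans lE; rewrite /links /= eqxx; apply: links_filter.
by exists F; split=> // X sX env; rewrite elimE // FE.
Qed.

End MPNNElimination.

(** * From homomorphism polynomials to networks *)

Section HomPolynomials.
Variables (R : realType) (n : nat) (H : mgraph).
Let V := 'I_(mg_m H).
Variable lab : V * V -> 'M[R]_n -> 'M[R]_n.

Definition mgraph_factors : seq (factor R n V) := [seq (e, lab e) | e <- mg_E H].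

Lemma hom_poly_marginal (X : 'M[R]_n) (i j : 'I_n) :
  (forall e (f : V -> 'I_n), lab e X (f e.1) (f e.2) = X (f e.1) (f e.2)) ->
  (mg_a H = mg_b H -> i = j) ->
  hom_poly H X i j = marginal (~: [set mg_a H; mg_b H]) mgraph_factors X
    [ffun u => if u == mg_a H then i else j].
Proof.
move=> labE ij; rewrite mxE /marginal.
apply: eq_big => [f|f _]; last first.
  by rewrite /weight big_map; apply: eq_bigr => e _; rewrite labE.
apply/andP/forallP => [[/eqP fa /eqP fb] u|agr].
  apply/implyP; rewrite !inE negbK ffunE => /orP[]/eqP->; rewrite ?eqxx ?fa //.
  by rewrite fb; case: (mg_b H =P mg_a H) => [ba|_] //; rewrite ij.
have ha := implyP (agr (mg_a H)); have hb := implyP (agr (mg_b H)).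
rewrite !inE !negbK !ffunE !eqxx ?orbT /= in ha hb.
rewrite (eqP (ha isT)) (eqP (hb isT)) !eqxx; split=> //.
by case: (mg_b H =P mg_a H) => [ba|_] //; rewrite ij.
Qed.

Lemma mgraph_factors_supported (B : {set V}) :
  supported (~: B :|: B) mgraph_factors.
Proof. by rewrite /supported all_map setUC setUCr; apply/allP => e _; rewrite !inE. Qed.

Lemma links_mgraph_factors : (links mgraph_factors <= size (mg_E H))%N.
Proof. by rewrite -(size_map (fun e => (e, lab e)) (mg_E H)) count_size. Qed.

End HomPolynomials.

Section HomNetworks.
Variables (R : realType) (s : R -> R) (n : nat).
Hypotheses (s_cont : continuous s) (s_nonpoly : ~ is_polynomial_fun s).

Lemma ppgn_hom_poly (H : mgraph) :
  (size (mg_E H) <= 4 + (mg_a H == mg_b H))%N ->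
  exists N : ppgn R 1, forall X : 'M[R]_n, simple_adj X -> forall i j,
    (mg_a H = mg_b H -> i = j) -> ppgn_eval s N X i j = hom_poly H X i j.
Proof.
move=> sE; pose E := mgraph_factors (H := H) (fun _ => @id 'M[R]_n).
have dB : [disjoint ~: [set mg_a H; mg_b H] & [set mg_a H; mg_b H]].
  by rewrite disjoint_sym -setI_eq0 setICr.
have labE : pp_labelled s E.
  rewrite /pp_labelled all_map; apply/allP => e _; apply/asboolP.
  exact: pp_computable_id.
have [F [cF FE]] := pp_marginal s_cont s_nonpoly dB
  (mgraph_factors_supported _ _) labE
  (leq_trans (links_mgraph_factors _) sE).
have [N NE] := pp_computable_network cF; exists N => X sX i j ij.
rewrite NE // (hom_poly_marginal (lab := fun _ => id)) // FE !ffunE eqxx.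
by case: (mg_b H =P mg_a H) => [ba|_] //; rewrite ij.
Qed.

Lemma mpnn_hom_poly (H : mgraph) : mg_a H = mg_b H -> (size (mg_E H) <= 2)%N ->
  exists N : mpnn R 1, forall X : 'M[R]_n, simple_adj X -> forall i,
    mpnn_eval s N X i = hom_poly H X i i.
Proof.
move=> ab sE.
(* The diagonal of a simple adjacency matrix is zero, so loops may carry the zero label, whose
   diagonal is trivially computable by an MPNN. *)
pose lab (e : 'I_(mg_m H) * 'I_(mg_m H)) : 'M[R]_n -> 'M[R]_n :=
  if e.1 == e.2 then fun=> const_mx 0 else id.
have dB : [disjoint ~: [set mg_a H] & [set mg_a H]].
  by rewrite disjoint_sym -setI_eq0 setICr.
have labE : mp_labelled s (mgraph_factors lab).
  rewrite /mp_labelled all_map; apply/allP => -[r q] _ /=; rewrite /lab /=.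
  case: eqP => _; apply/asboolP => //.
  have -> : (fun (_ : 'M[R]_n) i => (const_mx 0 : 'M[R]_n) i i) = (fun _ _ => 0).
    by apply/funext => X; apply/funext => i; rewrite mxE.
  exact: mp_computable_const.
have [F [cF FE]] := mp_marginal s_cont s_nonpoly dB
  (mgraph_factors_supported _ _) labE
  (leq_trans (links_mgraph_factors _) sE).
have [N NE] := mp_computable_network cF; exists N => X sX i.
rewrite NE // (hom_poly_marginal (lab := lab)) //.
  by rewrite -ab setUid FE // ffunE eqxx.
move=> [r q] f; rewrite /lab /=; case: eqP => // ->.
by rewrite mxE; case: sX => _ [_ ->].
Qed.

End HomNetworks.

Theorem theorem3 (R : realType) (s : R -> R)
  (s_cont : continuous s) (s_nonpoly : ~ is_polynomial_fun s)
  (n : nat) (n_ge1 : (1 <= n)%N) :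
  (* (i) PPGN++ is 4 edge polynomial expressive *)
  (forall (H : mgraph) (eps : R),
     mg_a H != mg_b H -> (size (mg_E H) <= 4)%N -> 0 < eps ->
     exists N : ppgn R 1,
       forall X : 'M[R]_n, simple_adj X ->
         forall i j, `|ppgn_eval s N X i j - hom_poly H X i j| < eps) /\
  (* (ii) PPGN++ is 5 node polynomial expressive *)
  (forall (H : mgraph) (eps : R),
     mg_a H = mg_b H -> (size (mg_E H) <= 5)%N -> 0 < eps ->
     exists N : ppgn R 1,
       forall X : 'M[R]_n, simple_adj X ->
         forall i, `|ppgn_eval s N X i i - hom_poly H X i i| < eps) /\
  (* (iii) MPNN is 2 node polynomial expressive *)
  (forall (H : mgraph) (eps : R),
     mg_a H = mg_b H -> (size (mg_E H) <= 2)%N -> 0 < eps ->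
     exists N : mpnn R 1,
       forall X : 'M[R]_n, simple_adj X ->
         forall i, `|mpnn_eval s N X i - hom_poly H X i i| < eps).
Proof.
(* The networks are exact on simple graphs, so the error is [0], below any [eps]. *)
split; [|split] => H eps ab sE eps0.
- have [|N NE] := @ppgn_hom_poly R s n s_cont s_nonpoly H.
    by rewrite (negPf ab) addn0.
  exists N => X sX i j; rewrite NE ?subrr ?normr0 // => ab'.
  by rewrite ab' eqxx in ab.
- have [|N NE] := @ppgn_hom_poly R s n s_cont s_nonpoly H.
    by rewrite ab eqxx.
  by exists N => X sX i; rewrite NE ?subrr ?normr0.
- have [N NE] := @mpnn_hom_poly R s n s_cont s_nonpoly H ab sE.
  by exists N => X sX i; rewrite NE ?subrr ?normr0.
Qed.
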